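(* Let $G=(V,E)$ be a cocomparability graph with $n$ vertices and $m$ edges, and let $\sigma$ be an LDFS umbrella-free ordering of $V$. Then the algorithm RMM$(G,\sigma)$ returns a maximum-cardinality matching $M$ of $G$, and it runs in $O(n+m)$ time.
   Context: A matching is a set of pairwise disjoint edges; a maximum(-cardinality) matching is a matching with the largest number of edges. A graph is a cocomparability graph if its complement admits a transitive orientation. An ordering $\pi$ of $V$ is umbrella-free if for all $x<_\pi y<_\pi z$ with $\{x,z\}\in E$ we have $\{x,y\}\in E$ or $\{y,z\}\in E$. For an ordering $\sigma$ of $V$, a triple $a<_\sigma b<_\sigma c$ with $\{a,c\}\in E$ and $\{a,b\}\notin E$ is a good triple if there is a vertex $d$ with $a<_\sigma d<_\sigma b$, $\{d,b\}\in E$ and $\{d,c\}\notin E$, and a bad triple otherwise; $\sigma$ is an LDFS ordering if it has no bad triple. An LDFS umbrella-free ordering is an ordering that is simultaneously an LDFS ordering and umbrella-free. Algorithm RMM$(G,\sigma)$ (Rightmost Matching): initially all vertices are unvisited and $M=\emptyset$. While unvisited vertices remain: pick the rightmost (in $\sigma$) unvisited vertex $x$ and mark it visited; if $x$ has at least one unvisited neighbor, pick the rightmost (in $\sigma$) unvisited neighbor $y$ of $x$, mark $y$ visited, and add $\{x,y\}$ to $M$. Finally return $M$ (together with the order in which vertices were visited). *)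

(* Defs.v *)
From mathcomp Require Import all_boot.

Set Implicit Arguments.
Unset Strict Implicit.
Unset Printing Implicit Defensive.

Definition simple_graph (T : finType) (e : rel T) : Prop :=
  symmetric e /\ irreflexive e.

Definition edges (T : finType) (e : rel T) : {set {set T}} :=
  [set [set x; y] | x in T, y in e x].

Definition is_matching (T : finType) (e : rel T) (M : {set {set T}}) : Prop :=
  M \subset edges e /\ trivIset M.

Definition is_maximum_matching
    (T : finType) (e : rel T) (M : {set {set T}}) : Prop :=
  is_matching e M /\ forall M', is_matching e M' -> #|M'| <= #|M|.

Definition complement (T : finType) (e : rel T) : rel T :=
  [rel x y | (x != y) && ~~ e x y].

Definition orientation (T : finType) (e r : rel T) : Prop :=
  (forall x y, r x y -> e x y) /\ (forall x y, e x y -> r x y (+) r y x).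

Definition cocomparability (T : finType) (e : rel T) : Prop :=
  exists r : rel T, orientation (complement e) r /\ transitive r.

(* An ordering of T is a sequence listing every vertex exactly once, from     *)
(* leftmost to rightmost.                                                     *)

Definition is_ordering (T : finType) (s : seq T) : Prop := perm_eq s (enum T).

Definition before (T : finType) (s : seq T) : rel T :=
  [rel x y | index x s < index y s].

Definition umbrella_free (T : finType) (e : rel T) (s : seq T) : Prop :=
  forall x y z, before s x y -> before s y z -> e x z -> e x y || e y z.

Definition ldfs_triple (T : finType) (e : rel T) (s : seq T) (a b c : T) :=
  [&& before s a b, before s b c, e a c & ~~ e a b].

Definition good_triple
    (T : finType) (e : rel T) (s : seq T) (a b c : T) : Prop :=
  ldfs_triple e s a b c /\
  exists d, [&& before s a d, before s d b, e d b & ~~ e d c].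

Definition bad_triple
    (T : finType) (e : rel T) (s : seq T) (a b c : T) : Prop :=
  ldfs_triple e s a b c /\ ~ good_triple e s a b c.

Definition ldfs_ordering (T : finType) (e : rel T) (s : seq T) : Prop :=
  forall a b c, ~ bad_triple e s a b c.

Definition rightmost (T : finType) (s : seq T) (P : pred T) : option T :=
  ohead [seq x <- rev s | P x].

(* The visited vertices, in the order in which they were visited, and the     *)
(* matching built so far.                                                     *)
Record rmm_state (T : finType) := RmmState {
  visits : seq T;
  matching : {set {set T}} }.

Definition rmm_step (T : finType) (e : rel T) (s : seq T)
    (st : rmm_state T) : rmm_state T :=
  let: RmmState vs M := st in
  if rightmost s [pred x | x \notin vs] is Some x then
    let vs' := rcons vs x in
    if rightmost s [pred y | e x y & y \notin vs'] is Some y then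
      RmmState (rcons vs' y) ([set x; y] |: M)
    else RmmState vs' M
  else st.

(* A step visits at least one vertex while some vertex is unvisited and does  *)
(* nothing afterwards, so #|T| steps run the loop to completion.              *)
Definition rmm (T : finType) (e : rel T) (s : seq T) : rmm_state T :=
  iter #|T| (rmm_step e s) (RmmState [::] set0).

(* Running time is measured on a random-access machine in its structured      *)
(* form: a program uses a fixed finite set of registers and arrays over nat,  *)
(* named by literals, and an array is read or written at a computed index in  *)
(* unit time.  Successor and predecessor are the only arithmetic, so after t  *)
(* steps no value exceeds the largest literal or input value by more than t:  *)
(* linear time implies words of O(log (n + m)) bits, and unit cost is honest. *)

Inductive expr :=
  | Const of nat
  | Reg of nat
  | Get of nat & expr
  | Succ of expr
  | Pred of expr.

Inductive test :=
  | Eq of expr & expr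
  | Lt of expr & expr.

Inductive cmd :=
  | Skip
  | Assign of nat & expr
  | Put of nat & expr & expr
  | Then of cmd & cmd
  | If of test & cmd & cmd
  | While of test & cmd.

Record store := Store {
  reg : nat -> nat;
  arr : nat -> nat -> nat }.

Fixpoint eval (st : store) (a : expr) : nat :=
  match a with
  | Const k => k
  | Reg r => reg st r
  | Get i a1 => arr st i (eval st a1)
  | Succ a1 => (eval st a1).+1
  | Pred a1 => (eval st a1).-1
  end.

Fixpoint expr_cost (a : expr) : nat :=
  match a with
  | Const _ | Reg _ => 1
  | Get _ a1 | Succ a1 | Pred a1 => (expr_cost a1).+1
  end.

Definition holds (st : store) (b : test) : bool :=
  match b with
  | Eq a1 a2 => eval st a1 == eval st a2
  | Lt a1 a2 => eval st a1 < eval st a2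
  end.

Definition test_cost (b : test) : nat :=
  match b with
  | Eq a1 a2 | Lt a1 a2 => (expr_cost a1 + expr_cost a2).+1
  end.

Definition update (A : Type) (f : nat -> A) (k : nat) (v : A) : nat -> A :=
  fun i => if i == k then v else f i.

Definition set_reg (st : store) (r v : nat) : store :=
  Store (update (reg st) r v) (arr st).

Definition set_arr (st : store) (i k v : nat) : store :=
  Store (reg st) (update (arr st) i (update (arr st i) k v)).

(* exec p st t st': started in st, p halts in st' after t elementary steps.   *)
Inductive exec : cmd -> store -> nat -> store -> Prop :=
  | ExecSkip st : exec Skip st 1 st
  | ExecAssign r a st :
      exec (Assign r a) st (expr_cost a).+1 (set_reg st r (eval st a))
  | ExecPut i a1 a2 st :
      exec (Put i a1 a2) st (expr_cost a1 + expr_cost a2).+1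
           (set_arr st i (eval st a1) (eval st a2))
  | ExecThen p1 p2 st1 t1 st2 t2 st3 :
      exec p1 st1 t1 st2 -> exec p2 st2 t2 st3 ->
      exec (Then p1 p2) st1 (t1 + t2) st3
  | ExecIf b p1 p2 st1 t st2 :
      exec (if holds st1 b then p1 else p2) st1 t st2 ->
      exec (If b p1 p2) st1 (test_cost b + t) st2
  | ExecWhileFalse b p st :
      ~~ holds st b -> exec (While b p) st (test_cost b) st
  | ExecWhileTrue b p st1 t1 st2 t2 st3 :
      holds st1 b -> exec p st1 t1 st2 -> exec (While b p) st2 t2 st3 ->
      exec (While b p) st1 (test_cost b + t1 + t2) st3.

Definition vnum (T : finType) (x : T) : nat := enum_rank x.

Definition adjacency_lists (T : finType) (e : rel T) (adj : T -> seq T) : Prop :=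
  forall x, perm_eq (adj x) (enum (e x)).

(* Input layout: register 0 holds n; array 0 holds the ordering; array 2 is   *)
(* the concatenation of the adjacency lists of the vertices 0, ..., n - 1,    *)
(* the list of vertex v occupying the cells k with                            *)
(* array1[v] <= k < array1[v + 1].  Everything else is 0.                     *)
Definition input (T : finType) (s : seq T) (adj : T -> seq T) : store :=
  Store (fun r => if r is 0 then #|T| else 0)
        (fun i => nth 0 (match i with
           | 0 => [seq vnum x | x <- s]
           | 1 => 0 :: scanl addn 0 [seq size (adj x) | x <- enum T]
           | 2 => flatten [seq [seq vnum y | y <- adj x] | x <- enum T]
           | _ => [::]
           end)).

(* Output layout: array 3 lists the vertices in the order of their visits;    *)
(* array 4 maps a vertex to the successor of its partner, or to 0 if it is    *)
(* unmatched (the bound n excludes every other value).                        *)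
Definition returns (T : finType) (st : store) (res : rmm_state T) : Prop :=
  [/\ [seq arr st 3 k | k <- iota 0 #|T|] = [seq vnum x | x <- visits res],
      forall x : T, arr st 4 (vnum x) <= #|T|
    & forall x y : T,
        ([set x; y] \in matching res) = (arr st 4 (vnum x) == (vnum y).+1)].

(* p is an implementation of the algorithm: on every graph, given by          *)
(* adjacency lists in any order, and every vertex ordering, it halts and      *)
(* returns the matching and the order of visits.                              *)
Definition implements_rmm (p : cmd) : Prop :=
  forall (T : finType) (e : rel T) (s : seq T) (adj : T -> seq T),
    simple_graph e -> is_ordering s -> adjacency_lists e adj ->
    exists t st, exec p (input s adj) t st /\ returns st (rmm e s).

(* Main.v *)
(* Optimality.  In an umbrella-free ordering the non-edges x < y form a poset,
   of which the ordering is a linear extension; RMM is list scheduling of the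
   reversed poset on two processors, the matched pairs being the steps that use
   both, and the LDFS condition says that the priorities are those of Coffman
   and Graham.  Their proof applies.  Reading the run backwards, cut the visited
   vertices into blocks: a step (x, y) whose y is missing, or lies to the left of
   the vertex that opened the current block, closes this block, moves y (if any)
   to a separator S, and opens a new block with x; every other step adds both of
   its vertices to the current block.  No edge joins two blocks, so an edge that
   avoids S lies in one block, and a matching has at most |S| plus the sum of the
   floor(|B| / 2) edges.  A pair found by RMM raises this bound by one and a single
   vertex does not raise it, so RMM attains it.

   Running time.  The program scans the ordering from right to left and, for
   every vertex x that it finds unvisited, reads the adjacency list of x once to
   find the rightmost unvisited neighbor; the degrees sum to at most 2 m. *)
Require Import Defs.
From mathcomp Require Import all_boot zify.

Set Implicit Arguments.
Unset Strict Implicit.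
Unset Printing Implicit Defensive.

(** * Upper bounds on matchings, and the degree sum *)

Section Matchings.
Variables (T : finType) (e : rel T).
Hypothesis e_simple : simple_graph e.
Implicit Types (M : {set {set T}}) (A B S : {set T}).

Lemma edgesP (E : {set T}) :
  reflect (exists x y, e x y /\ E = [set x; y]) (E \in edges e).
Proof.
apply: (iffP imset2P) => [[x y _ exy ->]|[x [y [exy ->]]]]; first by exists x, y.
by exists x y.
Qed.

Lemma card_edge (E : {set T}) : E \in edges e -> #|E| = 2.
Proof.
case/edgesP => x [y [exy ->]]; rewrite cards2.
by case: eqP exy => // ->; rewrite e_simple.2.
Qed.

Lemma is_matchingS M M' : M' \subset M -> is_matching e M -> is_matching e M'.
Proof.
by move=> sM [Me tM]; split; [apply: subset_trans sM Me | apply: trivIsetS sM tM].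
Qed.

Definition matching_bound A k :=
  forall M, is_matching e M -> cover M \subset A -> #|M| <= k.

Lemma matching_bound0 : matching_bound set0 0.
Proof.
move=> M [/subsetP Me _]; rewrite subset0 => /eqP M0.
rewrite leqn0 cards_eq0; apply/eqP/setP => E; rewrite inE.
apply/negP => EM; have : E \subset cover M by apply: bigcup_sup.
by rewrite M0 subset0 -cards_eq0 (card_edge (Me _ EM)).
Qed.

Lemma matching_bound_half A : matching_bound A #|A|./2.
Proof.
move=> M [/subsetP Me tM] /subset_leq_card MA.
rewrite geq_half_double (leq_trans _ MA) // -(eqP tM).
rewrite (eq_bigr (fun=> 2)) => [|E /Me /card_edge //].
by rewrite sum_nat_const muln2.
Qed.

(** With no edge between [A] and [B], each edge of [M] lies entirely in one of them. Those inside
    [A] form one matching and all the others lie inside [B]. *)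
Lemma matching_boundU A B k l :
  (forall a b, a \in A -> b \in B -> ~~ e a b) ->
  matching_bound A k -> matching_bound B l -> matching_bound (A :|: B) (k + l).
Proof.
move=> nAB bA bB M mM sM; pose MA := [set E in M | E \subset A].
have sMA : MA \subset M by apply/subsetP => E; rewrite inE => /andP[].
rewrite -(cardsID MA) (setIidPr sMA); apply: leq_add.
  apply: bA (is_matchingS sMA mM) _.
  by apply/bigcupsP => E; rewrite inE => /andP[].
apply: bB (is_matchingS (subsetDl _ _) mM) _.
apply/bigcupsP => E; rewrite !inE => /andP[+ EM]; rewrite EM /=.
have /subset_trans/(_ sM) : E \subset cover M by apply: bigcup_sup.
have /edgesP[x [y [exy ->]]] := subsetP mM.1 _ EM.
rewrite !subUset !sub1set !inE => /andP[/orP[xA|xB] /orP[yA|yB]].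
- by rewrite xA yA.
- by rewrite (negPf (nAB _ _ xA yB)) in exy.
- by rewrite e_simple.1 (negPf (nAB _ _ yA xB)) in exy.
- by rewrite xB yB.
Qed.

(** An edge of [M] that meets [S] is the block of any of its vertices in [S], so [pblock M] maps [S]
    onto a set containing all such edges. The remaining edges lie in [A]. *)
Lemma matching_bound_delete A S k :
  matching_bound A k -> matching_bound (S :|: A) (#|S| + k).
Proof.
move=> bA M mM sM; pose MS := [set E in M | E :&: S != set0].
have sMS : MS \subset M by apply/subsetP => E; rewrite inE => /andP[].
rewrite -(cardsID MS) (setIidPr sMS); apply: leq_add.
  apply: leq_trans (leq_imset_card (pblock M) S); apply: subset_leq_card.
  apply/subsetP => E; rewrite inE => /andP[EM /set0Pn[x /setIP[xE xS]]].
  by apply/imsetP; exists x => //; rewrite (def_pblock mM.2 EM xE).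
apply: bA (is_matchingS (subsetDl _ _) mM) _.
apply/bigcupsP => E; rewrite !inE => /andP[+ EM]; rewrite EM /= negbK => /eqP ES.
have /subset_trans/(_ sM)/subsetP sE : E \subset cover M by apply: bigcup_sup.
apply/subsetP => x xE; have := sE x xE; rewrite inE => /orP[xS|//].
by have := in_set0 x; rewrite -ES inE xE xS.
Qed.

(** Double counting of incidences: an edge has two ends, and [y] mapped to [[set x; y]] injects the
    neighbors of [x] into the edges at [x]. *)
Lemma sum_degrees : \sum_x #|e x| <= 2 * #|edges e|.
Proof.
have -> : 2 * #|edges e| = \sum_(E in edges e) #|E|.
  rewrite (eq_bigr (fun=> 2)) => [|E /card_edge //].
  by rewrite sum_nat_const mulnC.
have -> : \sum_(E in edges e) #|E| = \sum_x #|[set E in edges e | x \in E]|.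
  under eq_bigr do rewrite -sum1_card.
  rewrite (exchange_big_dep predT) //=.
  by apply: eq_bigr => x _; rewrite -sum1_card; apply: eq_bigl => E; rewrite in_set.
apply: leq_sum => x _.
have inj : {in e x &, injective (fun y => [set x; y])}.
  move=> y z exy exz /= /setP/(_ y); rewrite !in_set2 eqxx orbT => /esym/orP[]/eqP // yx.
  by move: exy; rewrite yx -topredE /= e_simple.2.
rewrite -(card_in_imset inj); apply: subset_leq_card; apply/subsetP => E.
case/imsetP => y exy ->; rewrite in_set in_set2 eqxx andbT.
by apply/edgesP; exists x, y.
Qed.

End Matchings.

(** * Rightmost vertices of an ordering *)

Section Rightmost.
Variables (T : finType) (s : seq T).
Hypothesis s_order : is_ordering s.

Lemma mem_ordering x : x \in s.
Proof. by rewrite (perm_mem s_order) mem_enum. Qed.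

Lemma uniq_ordering : uniq s.
Proof. by rewrite (perm_uniq s_order) enum_uniq. Qed.

Lemma size_ordering : size s = #|T|.
Proof. by rewrite (perm_size s_order) cardE. Qed.

Lemma index_ordering_inj : injective (index^~ s).
Proof. by move=> x y; apply: (index_inj x) (mem_ordering x) (mem_ordering y). Qed.

Variant rightmost_spec (P : pred T) : option T -> Prop :=
  | RightmostSome x of P x & (forall z, P z -> index z s <= index x s) :
      rightmost_spec P (Some x)
  | RightmostNone of (forall z, ~~ P z) : rightmost_spec P None.

Lemma rightmostP P : rightmost_spec P (rightmost s P).
Proof.
(* Maximality is restricted to members of the list, because the prefixes met in the induction no
   longer contain every vertex. *)
suff [[x [Px xs max] ->]|[nP ->]] : (exists2 x, [/\ P x, x \in s
    & forall z, z \in s -> P z -> index z s <= index x s]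
    & rightmost s P = Some x)
  \/ (forall z, z \in s -> ~~ P z) /\ rightmost s P = None.
- by constructor=> // z; apply: max (mem_ordering z).
- by constructor=> z; apply: nP (mem_ordering z).
move: uniq_ordering; rewrite /rightmost; elim/last_ind: (s) => [_|r a IH].
  by right.
rewrite rcons_uniq rev_rcons => /andP[ar ur] /=.
have [Pa|nPa] := boolP (P a).
  left; exists a => //; split=> // [|z zr _]; first by rewrite mem_rcons mem_head.
  rewrite -{2}cats1 index_cat (negPf ar) /= eqxx addn0.
  by rewrite -ltnS -(size_rcons r a) index_mem.
have idx z : z \in r -> index z (rcons r a) = index z r.
  by move=> zr; rewrite -cats1 index_cat zr.
case: (IH ur) => [[x [Px xr max]] E|[nP E]].
  left; exists x => //; split=> //.
    by rewrite mem_rcons inE xr orbT.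
  move=> z; rewrite mem_rcons inE => /predU1P[->|zr Pz]; first by rewrite (negPf nPa).
  by rewrite !idx // max.
right; split=> // z.
by rewrite mem_rcons inE => /predU1P[->|/nP].
Qed.

Lemma rightmost_unique (P : pred T) x :
  P x -> (forall z, P z -> index z s <= index x s) -> rightmost s P = Some x.
Proof.
move=> Px max; case: rightmostP => [y Py /(_ x Px) xy|/(_ x)]; last by rewrite Px.
by congr Some; apply/index_ordering_inj/eqP; rewrite eqn_leq xy max.
Qed.

Lemma rightmost_none (P : pred T) : (forall z, ~~ P z) -> rightmost s P = None.
Proof. by move=> nP; case: rightmostP => // x; rewrite (negPf (nP x)). Qed.

End Rightmost.

(** * Optimality of RMM *)

Section Certificates.
Variables (T : finType) (e : rel T) (s : seq T).
Hypotheses (e_simple : simple_graph e) (s_order : is_ordering s).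
Hypotheses (s_ldfs : ldfs_ordering e s) (s_umbrella : umbrella_free e s).
Local Notation pos x := (index x s).
Implicit Types (C F U : {set T}).

Definition prec : rel T := [rel x y | before s x y && ~~ e x y].

Lemma prec_trans : transitive prec.
Proof.
move=> y x z /andP[xy nxy] /andP[yz nyz]; apply/andP; split; first exact: ltn_trans yz.
by apply/negP => /(s_umbrella xy yz); rewrite (negPf nxy) (negPf nyz).
Qed.

(** [ldfs_ordering] merely denies bad triples. The search for [d] is a boolean existential over a
    finite type, so the witness can be extracted. *)
Lemma ldfs_witness a b c :
  prec a b -> before s b c -> e a c ->
  exists d, [/\ before s a d, before s d b, e d b & ~~ e d c].
Proof.
move=> /andP[ab nab] bc ac.
have abc : ldfs_triple e s a b c by apply/and4P.
pose P d := [&& before s a d, before s d b, e d b & ~~ e d c].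
have [/existsP[d /and4P[? ? ? ?]]|/existsP nP] := boolP [exists d, P d].
  by exists d.
by case: (@s_ldfs a b c); split=> // -[].
Qed.

(** Unvisited sets keep this property throughout the run. It guarantees that a vertex supplied by
    the LDFS condition is still unvisited. *)
Definition down_closed U := forall a b, prec a b -> b \in U -> a \in U.

(* [U] is the set of vertices unvisited at some time of the run.  [F] is the
   current block, [S] the separator and [C] the union of the closed blocks;
   [theta] is the position of the vertex [v] that opened [F] (0 for the block at
   the end of the run, which no vertex opened).  In [cert_pivot], [h] is a vertex
   of the block closed last; the last clause says that when [F] was opened all
   unvisited neighbors of [v] outside [F] were at or to the left of [h]. *)
Record certificate U m F S C theta k : Prop := Certificate {
  cert_cover : U \subset F :|: S :|: C;
  cert_open : F \subset U;
  cert_closed : C \subset U;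
  cert_theta : forall f, f \in F -> theta <= pos f;
  cert_sep : forall a f, a \in C -> f \in F -> ~~ e a f;
  cert_bound : matching_bound e C k;
  cert_size : #|S| + #|F|./2 + k <= m;
  cert_pivot : forall a, a \in C -> exists v h,
    [/\ v \in F, pos v = theta, a = h \/ prec a h, prec h v
      & forall d, d \in U :\: F -> e d v -> pos d <= pos h] }.

Definition certified U m := exists F S C theta k, certificate U m F S C theta k.

Lemma certified_all m M : certified setT m -> is_matching e M -> #|M| <= m.
Proof.
case=> F [S [C [theta [k [cov _ _ _ sep bC sz _]]]]] mM; apply: leq_trans sz.
rewrite -addnA; apply: matching_bound_delete mM _.
  apply: (matching_boundU e_simple) (@matching_bound_half _ _ e_simple F) bC => //.
  by move=> f a fF aC; rewrite e_simple.1 sep.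
by rewrite setUCA setUA (subset_trans (subsetT _)).
Qed.

Lemma certified_empty : certified set0 0.
Proof.
exists set0, set0, set0, 0, 0; split; rewrite ?sub0set ?cards0 //.
- by move=> a f; rewrite in_set0.
- exact: matching_bound0.
- by move=> a; rewrite in_set0.
Qed.

Variables (U : {set T}) (x : T).
Hypotheses (U_down : down_closed U) (xU : x \in U).
Hypothesis x_max : forall z, z \in U -> pos z <= pos x.

Lemma before_x z : z \in U -> z != x -> before s z x.
Proof.
move=> zU zx; rewrite /before /= ltn_neqAle x_max // andbT.
by apply: contra_neq zx => /(index_ordering_inj s_order).
Qed.

Lemma down_closed1 : (forall z, z \in U -> ~~ e x z) -> down_closed (U :\ x).
Proof.
move=> nx a b ab; rewrite !inE => /andP[bx bU]; rewrite (U_down ab bU) andbT.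
apply: contraTneq ab => ->; rewrite /prec /= negb_and -leqNgt x_max //.
Qed.

(** All other unvisited vertices precede [x], so [F] can be closed and [[set x]] opened. A single
    vertex contributes 0 to the bound, and the last clause of [cert_pivot] is vacuous because [x]
    has no neighbor in [U]. *)
Lemma certified_single m :
  (forall z, z \in U -> ~~ e x z) -> certified (U :\ x) m -> certified U m.
Proof.
move=> nx [F [S [C [theta [k [cov FU CU th sep bC sz piv]]]]]].
have sUx (A : {set T}) : A \subset U :\ x -> forall a, a \in A -> a \in U /\ prec a x.
  move=> /subsetP sA a /sA; rewrite !inE => /andP[ax aU]; split=> //.
  by rewrite /prec /= before_x // e_simple.1 nx.
have sU (A : {set T}) : A \subset U :\ x -> A \subset U.
  by move/subset_trans; apply; apply: subsetDl.
exists [set x], S, (F :|: C), (pos x), (#|F|./2 + k); split.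
- apply/subsetP => z zU; have := subsetP cov z; rewrite !inE zU andbT.
  by case: eqP => //= _ /(_ isT)/orP[/orP[]|] ->; rewrite ?orbT.
- by rewrite sub1set.
- by rewrite subUset !sU.
- by move=> f /set1P->.
- move=> a f + /set1P-> => /(sUx (F :|: C)); rewrite subUset FU CU => -[] // _.
  by case/andP.
- apply: (matching_boundU e_simple) (@matching_bound_half _ _ e_simple F) bC => //.
  by move=> f a fF aC; rewrite e_simple.1 sep.
- by rewrite cards1 addn0 addnA.
move=> a aFC.
have nd h d : d \in U :\: [set x] -> e d x -> pos d <= pos h.
  by rewrite !inE => /andP[_ dU]; rewrite e_simple.1 (negPf (nx _ dU)).
exists x; case/setUP: aFC => [aF|aC].
  exists a; split; rewrite ?inE //; [by left | by case: (sUx _ FU _ aF) | exact: nd].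
exists a; split; rewrite ?inE //; [by left | by case: (sUx _ CU _ aC) | exact: nd].
Qed.

Variable y : T.
Hypotheses (yU : y \in U) (exy : e x y).
Hypothesis y_max : forall z, z \in U -> e x z -> pos z <= pos y.

Let neq_xy : x != y.
Proof. by apply: contraTneq exy => <-; rewrite e_simple.2. Qed.

Let U' := U :\ x :\ y.

Lemma U'P z : z \in U' -> [/\ z \in U, z != x & z != y].
Proof. by rewrite !inE => /and3P[]. Qed.

Lemma prec_x z : z \in U' -> pos y < pos z -> prec z x.
Proof.
case/U'P=> zU zx _ yz; rewrite /prec /= before_x //.
by apply: contraTN yz; rewrite -leqNgt e_simple.1; apply: y_max.
Qed.

(** If [y] preceded a remaining [b], then [b] would lie to the right of [y] and hence precede [x].
    By transitivity [y] would precede [x], against the edge [e x y]. *)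
Lemma down_closed2 : down_closed U'.
Proof.
move=> a b ab bU'; have [bU bx _] := U'P bU'.
rewrite !inE (U_down ab bU) andbT; apply/andP; split; last first.
  by apply: contraTneq ab => ->; rewrite /prec /= negb_and -leqNgt x_max.
apply: contraTneq ab => ->; apply/negP => yb.
have := prec_trans yb (prec_x bU' _) => /(_ (proj1 (andP yb)))/andP[_].
by rewrite e_simple.1 exy.
Qed.

(** All of [F] lies to the right of [y], so it precedes [x] by the choice of [y]; through the
    pivots, so does [C]. Hence [F] is closed, [x] opens a new block, and the increment of [m] pays
    for [y] in the separator. *)
Lemma certified_split m F S C theta k :
  certificate U' m F S C theta k -> pos y < theta -> certified U m.+1.
Proof.
case=> cov FU CU th sep bC sz piv yth.
have sU (A : {set T}) : A \subset U' -> A \subset U.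
  by move/subsetP => sA; apply/subsetP => z /sA/U'P[].
have Fx f : f \in F -> prec f x.
  by move=> fF; apply: prec_x (subsetP FU _ fF) (leq_trans yth (th _ fF)).
have FCx a : a \in F :|: C -> prec a x.
  case/setUP => [/Fx //|/piv[v [h [vF _ ah hv _]]]].
  have hx := prec_trans hv (Fx _ vF).
  by case: ah => [->//|/prec_trans]; apply.
have y_left f d : f \in F -> d \in U :\: [set x] -> e d x -> pos d <= pos f.
  rewrite !inE => fF /andP[_ dU]; rewrite e_simple.1 => /(y_max dU)/leq_trans; apply.
  by apply: ltnW; apply: leq_trans yth (th _ fF).
exists [set x], (y |: S), (F :|: C), (pos x), (#|F|./2 + k); split.
- apply/subsetP => z zU; have := subsetP cov z; rewrite !inE zU andbT.
  by case: (z == x); case: (z == y); case: (z \in F); case: (z \in S) =>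
    //= /(_ isT) ->.
- by rewrite sub1set.
- by rewrite subUset !sU.
- by move=> f /set1P->.
- by move=> a f /FCx/andP[_ nax] /set1P->.
- apply: (matching_boundU e_simple) (@matching_bound_half _ _ e_simple F) bC => //.
  by move=> f a fF aC; rewrite e_simple.1 sep.
- by rewrite cards1 cardsU1 addn0; case: (y \in S) => /=; lia.
move=> a aFC; exists x.
case/setUP: aFC => [aF|aC].
  by exists a; split; rewrite ?set11 //; [left | apply: Fx | move=> d; apply: y_left].
(* The opener [v] of the block just closed becomes the new pivot [h], and [x] the new opener. *)
have [v [h [vF _ ah hv _]]] := piv a aC; exists v; split; rewrite ?set11 //.
- by right; case: ah => [->//|/prec_trans]; apply.
- exact: Fx.
- by move=> d; apply: y_left.
Qed.

(** Two more vertices in [F] raise its half by at most one. What must be shown is that no edge joins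
    [C] to [x] or [y]; as [a] equals or precedes the pivot [h], it suffices that [h] precedes
    both. *)
Lemma certified_extend m F S C theta k :
  certificate U' m F S C theta k -> theta <= pos y -> certified U m.+1.
Proof.
case=> cov FU CU th sep bC sz piv thy.
have yx : before s y x by apply: before_x; rewrite // eq_sym.
have Cz a z : a \in C -> z \in [set x; y] -> ~~ e a z.
  move=> aC zxy; have [v [h [vF vth ah hv max]]] := piv a aC.
  have [vU vx vy] := U'P (subsetP FU _ vF).
  have zU : z \in U by case/set2P: zxy => ->.
  have vz : before s v z.
    case/set2P: zxy => ->; first exact: before_x.
    rewrite /before /= ltn_neqAle vth thy andbT -vth.
    by apply: contra_neq vy => /(index_ordering_inj s_order).
  have hz : prec h z.
    apply/andP; split; first exact: ltn_trans (proj1 (andP hv)) vz.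
    (* The LDFS condition on (h, v, z) gives a neighbor d of v with h < d < v
       that is still unvisited, against the last clause of [cert_pivot]. *)
    apply/negP => /(ldfs_witness hv vz)[d [hd dv edv ndz]].
    have dz : prec d z by apply/andP; split=> //; apply: ltn_trans dv vz.
    have dU : d \in U' :\: F.
      rewrite !inE (U_down dz zU) andbT; apply/and3P; split.
      - by apply: contraL dv => /th; rewrite -leqNgt vth.
      - apply: contraTneq dz => ->; rewrite /prec /= negb_and negbK.
        by case/set2P: zxy => ->; rewrite /before /= ?ltnn // e_simple.1 exy orbT.
      - apply: contraTneq dz => ->; rewrite /prec /= negb_and -leqNgt.
        by rewrite x_max.
    by have := max d dU edv; rewrite leqNgt (hd : pos h < pos d).
  by case: ah => [->|/prec_trans/(_ hz)/andP[]//]; case/andP: hz.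
exists (x |: (y |: F)), S, C, theta, k; split=> //.
- apply/subsetP => z zU; have := subsetP cov z; rewrite !inE zU andbT.
  by case: (z == x); case: (z == y) => //= /(_ isT).
- rewrite !subUset !sub1set xU yU /=.
  by apply/subsetP => z /(subsetP FU)/U'P[].
- by apply/subsetP => z /(subsetP CU)/U'P[].
- move=> f; rewrite !inE => /or3P[/eqP->|/eqP->|/th] //.
  exact: leq_trans thy (ltnW yx).
- move=> a f aC; rewrite !inE orbA => /orP[|fF]; last exact: sep.
  by move=> fxy; apply: Cz; rewrite // !inE.
- rewrite (leq_trans _ (_ : (#|S| + #|F|./2 + k).+1 <= _)) // -addSn -addnS.
  rewrite leq_add2r leq_add2l -[_.+1]/(#|F|.+2./2); apply: half_leq.
  by rewrite !cardsU1; do 2![case: (_ \in _)] => //=; lia.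
move=> a aC; have [v [h [vF vth ah hv max]]] := piv a aC; exists v, h; split=> //.
  by rewrite !inE vF !orbT.
move=> d; rewrite !inE !negb_or -!andbA => /and4P[dx dy dF dU].
by apply: max; rewrite !inE dF dx dy.
Qed.

Lemma certified_pair m : certified U' m -> certified U m.+1.
Proof.
case=> F [S [C [theta [k cert]]]].
by case: (leqP theta (pos y)); [apply: certified_extend cert|apply: certified_split cert].
Qed.

End Certificates.

(** * From certificates to the optimality of the run *)

Section Optimality.
Variables (T : finType) (e : rel T) (s : seq T).
Hypotheses (e_simple : simple_graph e) (s_order : is_ordering s).
Local Notation pos x := (index x s).

Definition unvisited (st : rmm_state T) : {set T} := [set z | z \notin visits st].

Variant step_spec (st : rmm_state T) : rmm_state T -> Prop :=
  | StepDone of unvisited st = set0 : step_spec st st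
  | StepSingle x of x \in unvisited st
      & (forall z, z \in unvisited st -> pos z <= pos x)
      & (forall z, z \in unvisited st -> ~~ e x z) :
      step_spec st (RmmState (rcons (visits st) x) (matching st))
  | StepPair x y of x \in unvisited st & y \in unvisited st & e x y
      & (forall z, z \in unvisited st -> pos z <= pos x)
      & (forall z, z \in unvisited st -> e x z -> pos z <= pos y) :
      step_spec st (RmmState (rcons (rcons (visits st) x) y)
                             ([set x; y] |: matching st)).

Lemma rmm_stepP st : step_spec st (rmm_step e s st).
Proof.
case: st => vs M /=; case: rightmostP => //= [x xU x_max|all]; last first.
  by constructor; apply/setP => z; rewrite !inE; apply/negbTE/all.
(* Irreflexivity makes it immaterial whether [x] itself is already marked when its neighbors are
   searched. *)
have U1 z : e x z -> (z \notin rcons vs x) = (z \notin vs).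
  rewrite mem_rcons inE negb_or; case: eqP => // ->.
  by rewrite e_simple.2.
case: rightmostP => //= [y /andP[exy yU] y_max|nx].
  constructor; rewrite ?inE //; first by rewrite -(U1 _ exy).
    by move=> z; rewrite inE => /x_max.
  by move=> z; rewrite inE => zU exz; apply: y_max; rewrite exz U1.
constructor; rewrite ?inE //; first by move=> z; rewrite inE => /x_max.
move=> z; rewrite inE => zU; apply/negP => exz.
by have := nx z; rewrite exz U1 // zU.
Qed.

Lemma unvisited1 vs M x :
  unvisited (RmmState (rcons vs x) M) = unvisited (RmmState vs M) :\ x.
Proof. by apply/setP => z; rewrite !inE /= mem_rcons inE negb_or. Qed.

(** The second component makes each new edge disjoint from the earlier ones. *)
Definition rmm_wf (st : rmm_state T) :=
  is_matching e (matching st) /\ [disjoint cover (matching st) & unvisited st].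

Lemma rmm_wf_pair st x y : rmm_wf st -> x \in unvisited st -> y \in unvisited st ->
  trivIset ([set x; y] |: matching st) /\ [set x; y] \notin matching st.
Proof.
move=> [[/subsetP Me tM] dM] xU yU; apply: trivIsetU1 => // [B BM|].
  apply: (@disjointWl _ _ (mem (unvisited st))).
    by apply/subsetP => z; case/set2P => ->.
  by rewrite disjoint_sym; apply: disjointWl dM; apply: bigcup_sup.
by apply/negP => /Me/card_edge; rewrite cards0 => /(_ e_simple).
Qed.

Lemma step_wf st : rmm_wf st -> rmm_wf (rmm_step e s st).
Proof.
move=> wf; have [[Me tM] dM] := wf; case: rmm_stepP => [|x xU _ _|x y xU yU exy _ _] //.
  split=> //=; rewrite unvisited1; apply: disjointWr dM.
  by case: (st) => vs M; apply: subsetDl.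
split; [split|] => /=.
- by rewrite subUset sub1set Me andbT; apply/edgesP => //; exists x, y.
- by have [] := rmm_wf_pair wf xU yU.
rewrite !unvisited1; apply/pred0P => z /=; apply/negP => /andP[/bigcupP[B + zB]].
rewrite !inE /= => /predU1P[EB|BM] /and3P[zy zx zU].
  by move: zB; rewrite EB !inE (negPf zx) (negPf zy).
have /pred0P/(_ z)/= := dM; rewrite inE zU andbT => /negP; apply.
by apply/bigcupP; exists B.
Qed.

Hypotheses (s_ldfs : ldfs_ordering e s) (s_umbrella : umbrella_free e s).

(** The number [m] of edges still to be added is also the certified bound. The induction hypothesis
    treats the run after the first step, and that step extends the certificate backwards. *)
Lemma iter_certified n st :
  rmm_wf st -> down_closed e s (unvisited st) -> #|unvisited st| <= n ->
  exists2 m, certified e s (unvisited st) m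
    & #|matching (iter n (rmm_step e s) st)| = #|matching st| + m.
Proof.
elim: n st => [|n IH] st wf dU.
  rewrite leqn0 cards_eq0 => /eqP U0; exists 0; rewrite ?addn0 // U0.
  by apply: certified_empty.
have IHl st' : rmm_wf st' -> down_closed e s (unvisited st') ->
    unvisited st' \proper unvisited st -> #|unvisited st| <= n.+1 ->
    exists2 m, certified e s (unvisited st') m
      & #|matching (iter n (rmm_step e s) st')| = #|matching st'| + m.
  by move=> wf' dU' /proper_card lt /(leq_trans lt); apply: IH.
rewrite iterSr; have := step_wf wf; case: rmm_stepP.
- by move=> U0 _ _; apply: IH; rewrite // U0 cards0.
- move=> x xU x_max nx /IHl; rewrite unvisited1; case: (st) xU x_max nx dU wf => vs M /=.
  move=> xU x_max nx dU wf {}IH /IH[]; rewrite ?properD1 //; first exact: down_closed1.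
  by move=> m cm ->; exists m => //; apply: certified_single cm.
move=> x y xU yU exy x_max y_max /IHl; rewrite !unvisited1.
have [_ newM] := rmm_wf_pair wf xU yU.
case: (st) xU yU exy x_max y_max dU newM => vs M /=.
move=> xU yU exy x_max y_max dU newM {}IH /IH[].
- exact: down_closed2.
- by apply: sub_proper_trans (properD1 xU); apply: subsetDl.
move=> m cm ->; exists m.+1; first by apply: certified_pair cm.
by rewrite cardsU1 newM addnS.
Qed.

Lemma rmm_maximum : is_maximum_matching e (matching (rmm e s)).
Proof.
have wf0 : rmm_wf (RmmState [::] set0).
  split=> /=; last by rewrite /cover big_set0 -setI_eq0 set0I.
  by split; [rewrite sub0set | apply/trivIsetP => A B; rewrite in_set0].
split.
  have wf n : rmm_wf (iter n (rmm_step e s) (RmmState [::] set0)).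
    by elim: n => // n IH; apply: step_wf.
  by have [] := wf #|T|.
have U0 : unvisited (RmmState [::] set0) = setT by apply/setP => z; rewrite !inE.
move=> M' mM'; have [||m] := @iter_certified #|T| _ wf0; rewrite U0 ?cardsT //.
move=> cm; rewrite -/(rmm e s) cards0 add0n => ->.
exact: certified_all cm mM'.
Qed.

End Optimality.

(** * The program *)

Section Programs.
Implicit Types (p : cmd) (st : store) (Q : store -> Prop).

(** Transfers the time bound of one constructed execution to every execution. *)
Lemma exec_deterministic p st t1 st1 t2 st2 :
  exec p st t1 st1 -> exec p st t2 st2 -> t1 = t2 /\ st1 = st2.
Proof.
move=> ex; elim: ex t2 st2 => {p st t1 st1}; intros;
  match goal with H : exec _ _ ?t ?st |- _ = ?t /\ _ = ?st => inversion H; subst end;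
  try match goal with H : is_true (~~ ?b), H' : is_true ?b |- _ => by rewrite H' in H end;
  repeat match goal with
    IH : forall t st, exec ?p ?st1 t st -> _, H : exec ?p ?st1 _ _ |- _ =>
      case: (IH _ _ H) => ? ?; subst; clear IH
  end; by split.
Qed.

(** A total-correctness judgment with time budget [n]. *)
Definition runs p st n Q := exists t st', [/\ exec p st t st', t <= n & Q st'].

Lemma runs_weaken p st n n' Q Q' :
  n <= n' -> (forall st', Q st' -> Q' st') -> runs p st n Q -> runs p st n' Q'.
Proof.
by move=> le QQ' [t [st' [ex tn /QQ']]]; exists t, st'; split=> //; apply: leq_trans le.
Qed.

Lemma runs_then p1 p2 st n1 n2 Q :
  runs p1 st n1 (fun st1 => runs p2 st1 n2 Q) -> runs (Then p1 p2) st (n1 + n2) Q.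
Proof.
move=> [t1 [st1 [ex1 le1 [t2 [st2 [ex2 le2 HQ]]]]]]; exists (t1 + t2), st2.
by split; [apply: ExecThen ex2 | apply: leq_add |].
Qed.

Lemma runs_if b p1 p2 st n Q :
  runs (if holds st b then p1 else p2) st n Q ->
  runs (If b p1 p2) st (test_cost b + n) Q.
Proof.
move=> [t [st' [ex le HQ]]]; exists (test_cost b + t), st'.
by split; [apply: ExecIf | rewrite leq_add2l |].
Qed.

(** The invariant is indexed by the number of completed iterations. A separate budget for each
    iteration lets the adjacency scans add up to the degree sum. *)
Lemma runs_while b p n (cost : nat -> nat) (J : nat -> store -> Prop) st :
  (forall k st, k < n -> J k st -> holds st b /\ runs p st (cost k) (J k.+1)) ->
  (forall st, J n st -> ~~ holds st b) -> J 0 st ->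
  runs (While b p) st (\sum_(k < n) (test_cost b + cost k) + test_cost b) (J n).
Proof.
elim: n cost J st => [|n IH] cost J st body stop J0.
  rewrite big_ord0; exists (test_cost b), st; split=> //.
  by apply: ExecWhileFalse; apply: stop.
have [Hb [t1 [st1 [ex1 le1 J1]]]] := body 0 st isT J0.
have [t2 [st2 [ex2 le2 J2]]] :=
  IH (cost \o S) (J \o S) st1 (fun k st => body k.+1 st) stop J1.
exists (test_cost b + t1 + t2), st2; split=> //; first exact: ExecWhileTrue ex2.
by rewrite big_ord_recl -!addnA leq_add2l; apply: leq_add le1 le2.
Qed.

Fixpoint loop_free p : bool :=
  match p with
  | Then p1 p2 | If _ p1 p2 => loop_free p1 && loop_free p2
  | While _ _ => false
  | _ => true
  end.

(** An interpreter that lets straight-line code be verified by computation. Its value on [While],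
    like that of [cmd_cost], is a placeholder excluded by [loop_free]. *)
Fixpoint run p st : store :=
  match p with
  | Assign r a => set_reg st r (eval st a)
  | Put i a1 a2 => set_arr st i (eval st a1) (eval st a2)
  | Then p1 p2 => run p2 (run p1 st)
  | If b p1 p2 => if holds st b then run p1 st else run p2 st
  | _ => st
  end.

Fixpoint cmd_cost p : nat :=
  match p with
  | Assign _ a => (expr_cost a).+1
  | Put _ a1 a2 => (expr_cost a1 + expr_cost a2).+1
  | Then p1 p2 => cmd_cost p1 + cmd_cost p2
  | If b p1 p2 => test_cost b + maxn (cmd_cost p1) (cmd_cost p2)
  | _ => 1
  end.

Lemma runs_loop_free p st Q :
  loop_free p -> Q (run p st) -> runs p st (cmd_cost p) Q.
Proof.
move=> lf HQ; suff [t [ex le]] : exists t, exec p st t (run p st) /\ t <= cmd_cost p.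
  by exists t, (run p st).
elim: p st lf {HQ} => //=.
- by move=> st _; exists 1; split=> //; constructor.
- by move=> r a st _; exists (expr_cost a).+1; split=> //; constructor.
- by move=> i a1 a2 st _; eexists; split; [constructor | ].
- move=> p1 IH1 p2 IH2 st /andP[/(IH1 st)[t1 [ex1 le1]] /(IH2 (run p1 st))[t2 [ex2 le2]]].
  by exists (t1 + t2); split; [apply: ExecThen ex2 | apply: leq_add].
move=> b p1 IH1 p2 IH2 st /andP[/(IH1 st)[t1 [ex1 le1]] /(IH2 st)[t2 [ex2 le2]]].
case: (boolP (holds st b)) => Hb.
  exists (test_cost b + t1); split; first by apply: ExecIf; rewrite Hb.
  by rewrite leq_add2l (leq_trans le1) ?leq_maxl.
exists (test_cost b + t2); split; first by apply: ExecIf; rewrite (negPf Hb).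
by rewrite leq_add2l (leq_trans le2) ?leq_maxr.
Qed.

End Programs.

(** * The code of RMM *)

Local Notation "p1 ;; p2" := (Then p1 p2) (at level 100, right associativity).

(* Registers: 0 the number n of vertices; 1 the number of positions initialized,
   then the number of positions still to be treated; 2 the number of visits;
   3 the vertex x; 4 and 5 the ends of the unread part of its adjacency list;
   6 the successor of the position of the best neighbor so far (0 if none), then
   that neighbor y; 7 the neighbor read.
   Arrays 5 and 6, indexed by vertices: the successor of the position, and the
   visited flag. *)
Definition init_body :=
  Put 5 (Get 0 (Reg 1)) (Succ (Reg 1)) ;;
  Assign 1 (Succ (Reg 1)).

Definition mark r :=
  Put 6 (Reg r) (Const 1) ;;
  Put 3 (Reg 2) (Reg r) ;;
  Assign 2 (Succ (Reg 2)).

Definition scan_body :=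
  Assign 7 (Get 2 (Reg 4)) ;;
  If (Eq (Get 6 (Reg 7)) (Const 0))
    (If (Lt (Reg 6) (Get 5 (Reg 7))) (Assign 6 (Get 5 (Reg 7))) Skip)
    Skip ;;
  Assign 4 (Succ (Reg 4)).

Definition link :=
  Put 4 (Reg 3) (Succ (Reg 6)) ;;
  Put 4 (Reg 6) (Succ (Reg 3)).

Definition open_scan :=
  Assign 4 (Get 1 (Reg 3)) ;;
  Assign 5 (Get 1 (Succ (Reg 3))) ;;
  Assign 6 (Const 0).

Definition pair_up :=
  If (Lt (Const 0) (Reg 6))
    (Assign 6 (Get 0 (Pred (Reg 6))) ;; mark 6 ;; link)
    Skip.

Definition visit :=
  mark 3 ;;
  open_scan ;;
  While (Lt (Reg 4) (Reg 5)) scan_body ;;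
  pair_up.

Definition main_body :=
  (Assign 1 (Pred (Reg 1)) ;; Assign 3 (Get 0 (Reg 1))) ;;
  If (Eq (Get 6 (Reg 3)) (Const 0)) visit Skip.

Definition rmm_program :=
  While (Lt (Reg 1) (Reg 0)) init_body ;;
  While (Lt (Const 0) (Reg 1)) main_body.

Lemma bigmax_seq_attained (I : eqType) (r : seq I) (P : pred I) (F : I -> nat) :
  0 < \max_(i <- r | P i) F i ->
  exists2 i, i \in r & P i /\ \max_(i <- r | P i) F i = F i.
Proof.
elim: r => [|i r IH]; first by rewrite big_nil.
rewrite big_cons; case Pi: (P i); last first.
  by move/IH => [j jr ?]; exists j => //; rewrite inE jr orbT.
case: (leqP (\max_(j <- r | P j) F j) (F i)) => [le _|lt _].
  by exists i; rewrite ?mem_head.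
by have [j jr ?] := IH (leq_ltn_trans (leq0n _) lt); exists j; rewrite // inE jr orbT.
Qed.

(** * Correctness and running time of the code *)

Section Implementation.
Variables (T : finType) (e : rel T) (s : seq T) (adj : T -> seq T).
Hypotheses (e_simple : simple_graph e) (s_order : is_ordering s).
Hypothesis adj_lists : adjacency_lists e adj.
Local Notation pos x := (index x s).

Lemma vnum_inj : injective (@vnum T).
Proof. by move=> x y /val_inj/enum_rank_inj. Qed.

Lemma vnum_lt (x : T) : vnum x < #|T|.
Proof. exact: ltn_ord. Qed.

Lemma nth_enum_vnum x0 (x : T) : nth x0 (enum T) (vnum x) = x.
Proof. exact: nth_enum_rank. Qed.

Lemma ex_pos k : k < #|T| -> exists x, pos x = k.
Proof.
rewrite -(size_ordering s_order) => ks; have x0 : T by case: (s) ks.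
by exists (nth x0 s k); rewrite index_uniq // (uniq_ordering s_order).
Qed.

Lemma mem_adj x y : (y \in adj x) = e x y.
Proof. by rewrite (perm_mem (adj_lists x)) mem_enum. Qed.

Let inp := input s adj.

Lemma input_order x : arr inp 0 (pos x) = vnum x.
Proof.
by rewrite /= (nth_map x) ?nth_index ?index_mem ?mem_ordering.
Qed.

Let off (x : T) := arr inp 1 (vnum x).

(** [scanl] omits its starting value, hence [k.+1] summands at index [k]; the explicit leading 0 in
    [input] compensates for this. *)
Lemma nth_scanl_addn l k a :
  k < size l -> nth 0 (scanl addn a l) k = a + sumn (take k.+1 l).
Proof.
elim: l k a => //= b l IH [|k] a lt /=; first by rewrite take0 addn0.
by rewrite IH // addnA.
Qed.

Lemma input_offset k : k <= #|T| ->
  arr inp 1 k = sumn (take k [seq size (adj x) | x <- enum T]).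
Proof.
case: k => [|k] lt /=; first by rewrite take0.
by rewrite nth_scanl_addn // size_map -cardE.
Qed.

Lemma input_offsetS x : arr inp 1 (vnum x).+1 = off x + size (adj x).
Proof.
rewrite /off !input_offset ?(ltnW (vnum_lt x)) ?vnum_lt //.
have lt : vnum x < size [seq size (adj x) | x <- enum T].
  by rewrite size_map -cardE vnum_lt.
rewrite (take_nth 0) // sumn_rcons (nth_map x) ?nth_enum_vnum //.
by rewrite -cardE vnum_lt.
Qed.

Lemma nth_flatten_sumn (ss : seq (seq nat)) i k :
  k < size (nth [::] ss i) ->
  nth 0 (flatten ss) (sumn (take i (shape ss)) + k) = nth 0 (nth [::] ss i) k.
Proof.
elim: ss i => [|l ss IH] [|i] //= lt; first by rewrite nth_cat lt.
by rewrite nth_cat -addnA ltnNge leq_addr /= addKn IH.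
Qed.

Lemma input_adj x k :
  k < size (adj x) -> arr inp 2 (off x + k) = vnum (nth x (adj x) k).
Proof.
move=> lt; have nx : nth [::] [seq [seq vnum y | y <- adj x] | x <- enum T] (vnum x)
    = [seq vnum y | y <- adj x].
  by rewrite (nth_map x) ?nth_enum_vnum // -cardE vnum_lt.
rewrite /off input_offset ?(ltnW (vnum_lt x)) //=.
have -> : [seq size (adj x) | x <- enum T]
    = shape [seq [seq vnum y | y <- adj x] | x <- enum T].
  by rewrite /shape -map_comp; apply: eq_map => z /=; rewrite size_map.
by rewrite nth_flatten_sumn nx ?size_map // (nth_map x).
Qed.

Definition input_kept st :=
  [/\ reg st 0 = #|T|, arr st 0 = arr inp 0, arr st 1 = arr inp 1 & arr st 2 = arr inp 2].

(** [rep_unmatched] ensures that [link] never overwrites an earlier partner. *)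
Record represents (rs : rmm_state T) st : Prop := Represents {
  rep_input : input_kept st;
  rep_pos : forall x, arr st 5 (vnum x) = (pos x).+1;
  rep_uniq : uniq (visits rs);
  rep_size : reg st 2 = size (visits rs);
  rep_visits : [seq arr st 3 k | k <- iota 0 (size (visits rs))]
               = [seq vnum x | x <- visits rs];
  rep_visited : forall x, arr st 6 (vnum x) = (x \in visits rs);
  rep_partner_le : forall x : T, arr st 4 (vnum x) <= #|T|;
  rep_matching : forall x y : T,
    ([set x; y] \in matching rs) = (arr st 4 (vnum x) == (vnum y).+1);
  rep_unmatched : forall x : T, x \notin visits rs -> arr st 4 (vnum x) = 0 }.

Lemma represents_regs rs st st' :
  arr st' = arr st -> reg st' 0 = reg st 0 -> reg st' 2 = reg st 2 ->
  represents rs st -> represents rs st'.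
Proof.
by move=> ea e0 e2 [? ? ? ? ? ? ? ? ?]; split; rewrite /input_kept ?ea ?e0 ?e2.
Qed.

Lemma represents_mark r rs st x :
  represents rs st -> reg st r = vnum x -> x \notin visits rs ->
  represents (RmmState (rcons (visits rs) x) (matching rs)) (run (mark r) st).
Proof.
move=> [[i0 i1 i2 i3] hp hu hs hv hd hl hm hn] rx xv.
split=> //.
- by rewrite /= rcons_uniq xv.
- by rewrite /= /update /= size_rcons hs.
- have iotaS k : iota 0 k.+1 = rcons (iota 0 k) k by rewrite -addn1 iotaD cats1.
  rewrite /= map_rcons -hv size_rcons iotaS map_rcons.
  rewrite /= /update /= hs eqxx rx; congr rcons.
  by apply/eq_in_map => k; rewrite mem_iota => /ltn_eqF ->.
- move=> z; rewrite /= /update /= rx mem_rcons inE (inj_eq vnum_inj).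
  by case: eqP => //= _.
- by move=> z; rewrite /= mem_rcons inE negb_or => /andP[_ /hn].
Qed.

Lemma eq_set2l (x y v : T) : x != y -> ([set x; v] == [set x; y]) = (v == y).
Proof.
move=> xy; apply/eqP/eqP => [/setP/(_ y)|-> //].
by rewrite !inE eqxx orbT eq_sym (negPf xy) /= => /eqP.
Qed.

Lemma represents_link rs st x y :
  represents rs st -> reg st 3 = vnum x -> reg st 6 = vnum y -> x != y ->
  x \in visits rs -> y \in visits rs ->
  arr st 4 (vnum x) = 0 -> arr st 4 (vnum y) = 0 ->
  represents (RmmState (visits rs) ([set x; y] |: matching rs)) (run link st).
Proof.
move=> [[i0 i1 i2 i3] hp hu hs hv hd hl hm hn] rx ry xy xv yv x0 y0.
have ax z : arr (run link st) 4 (vnum z) =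
    if z == y then (vnum x).+1 else if z == x then (vnum y).+1 else arr st 4 (vnum z).
  by rewrite /= /update /= rx ry !(inj_eq vnum_inj).
split=> //.
- by move=> z; rewrite ax; case: (z == y); last case: (z == x); rewrite ?vnum_lt.
- move=> u v; rewrite ax /= in_setU1.
  have unm w : arr st 4 (vnum w) = 0 -> [set w; v] \in matching rs = false.
    by move=> w0; rewrite hm w0.
  case: (u =P y) => [->|/eqP uy].
    rewrite unm // orbF [X in _ == X]setUC eq_set2l 1?eq_sym //.
    by rewrite eqSS (inj_eq vnum_inj) eq_sym.
  case: (u =P x) => [->|/eqP ux].
    by rewrite unm // orbF eq_set2l // eqSS (inj_eq vnum_inj) eq_sym.
  rewrite hm; case: eqP => //= /setP/(_ u); rewrite !inE eqxx (negPf ux) (negPf uy).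
  by [].
move=> z zv; rewrite ax hn //; case: eqP => [zy|_]; first by rewrite zy yv in zv.
by case: eqP => // zx; rewrite zx xv in zv.
Qed.

(** Positions are shifted by one so that 0, the empty maximum, can mean that no candidate exists. *)
Definition best_pos (vs l : seq T) := \max_(y <- l | y \notin vs) (pos y).+1.

Variant best_spec (vs : seq T) x : nat -> option T -> Prop :=
  | BestNone : best_spec vs x 0 None
  | BestSome y of e x y & y \notin vs : best_spec vs x (pos y).+1 (Some y).

Lemma bestP vs x :
  best_spec vs x (best_pos vs (adj x)) (rightmost s [pred y | e x y & y \notin vs]).
Proof.
have [|b0] := posnP (best_pos vs (adj x)).
  move=> b0; rewrite b0 (rightmost_none s_order); first by constructor.
  move=> y /=; rewrite -mem_adj; apply/negP => /andP[yx yv].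
  have := @leq_bigmax_seq _ (adj x) (fun y => y \notin vs) (fun y => (pos y).+1) y yx yv.
  by rewrite -/(best_pos _ _) b0.
have [y yx [yv E]] := bigmax_seq_attained b0; rewrite {1}/best_pos E.
rewrite mem_adj in yx; rewrite (rightmost_unique s_order (x := y)) //=.
- by constructor.
- by rewrite yx yv.
move=> z /andP[]; rewrite -mem_adj -ltnS -E => zx zv.
exact: (@leq_bigmax_seq _ (adj x) (fun y => y \notin vs) (fun y => (pos y).+1)).
Qed.

(** Each 3 is the cost of the loop test; the last one pays for the test that fails. *)
Definition scan_cost d := d * (3 + cmd_cost scan_body) + 3.

Lemma runs_scan rs st x :
  represents rs st -> reg st 3 = vnum x -> reg st 4 = off x ->
  reg st 5 = off x + size (adj x) -> reg st 6 = 0 ->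
  runs (While (Lt (Reg 4) (Reg 5)) scan_body) st (scan_cost (size (adj x)))
    (fun st' => [/\ arr st' = arr st, forall r, r < 4 -> reg st' r = reg st r
                  & reg st' 6 = best_pos (visits rs) (adj x)]).
Proof.
move=> rep r3 r4 r5 r6.
pose J k st' := [/\ arr st' = arr st, forall r, r < 4 -> reg st' r = reg st r,
  reg st' 4 = off x + k, reg st' 5 = off x + size (adj x)
  & reg st' 6 = best_pos (visits rs) (take k (adj x))].
have := @runs_while (Lt (Reg 4) (Reg 5)) scan_body (size (adj x))
  (fun=> cmd_cost scan_body) J st.
rewrite sum_nat_const card_ord => loop.
apply: runs_weaken (leqnn _) _ (loop _ _ _) => [st' [ea er _ _]|k st' kd|st' [_ _ e4 e5 _]|].
- by rewrite take_size.
- case=> ea er e4 e5 e6; split; first by rewrite /= e4 e5 ltn_add2l.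
  apply: runs_loop_free => //.
  have ey : arr st' 2 (reg st' 4) = vnum (nth x (adj x) k).
    by have [[_ _ _ i2] _ _ _ _ _ _ _ _] := rep; rewrite ea i2 e4 input_adj.
  have e6v : arr st' 6 (vnum (nth x (adj x) k)) = (nth x (adj x) k \in visits rs).
    by rewrite ea (rep_visited rep).
  have e5p : arr st' 5 (vnum (nth x (adj x) k)) = (pos (nth x (adj x) k)).+1.
    by rewrite ea (rep_pos rep).
  have best_k : best_pos (visits rs) (take k.+1 (adj x)) =
      if nth x (adj x) k \in visits rs then reg st' 6
      else maxn (reg st' 6) (pos (nth x (adj x) k)).+1.
    by rewrite e6 /best_pos (take_nth x) // big_rcons /=; case: (_ \in visits rs).
  move: (nth x (adj x) k) ey e6v e5p best_k => y ey e6v e5p best_k.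
  rewrite /J best_k /= /update /= ey e6v; case: (y \in visits rs) => /=.
    by rewrite /update /= e4 addnS; split=> // -[|[|[|[|r]]]] // lt4; apply: er lt4.
  rewrite e5p /update /=; case: leqP => _ /=; rewrite /update /= e4 addnS;
    by split=> // -[|[|[|[|r]]]] // lt4; apply: er lt4.
- by rewrite /= e4 e5 ltnn.
by rewrite /J take0 /best_pos big_nil r4 r5 r6 addn0.
Qed.

Definition visit_cost d :=
  cmd_cost (mark 3) + (cmd_cost open_scan + (scan_cost d + cmd_cost pair_up)).

Lemma runs_visit rs st x :
  represents rs st -> reg st 3 = vnum x ->
  rightmost s [pred z | z \notin visits rs] = Some x ->
  runs visit st (visit_cost (size (adj x)))
    (fun st' => represents (rmm_step e s rs) st' /\ reg st' 1 = reg st 1).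
Proof.
move=> rep r3 max_x; have xv : x \notin visits rs.
  by move: max_x; case: rightmostP => // z zv _ [<-].
have r3m : reg (run (mark 3) st) 3 = vnum x by [].
have a4m : arr (run (mark 3) st) 4 = arr st 4 by [].
have r1m : reg (run (mark 3) st) 1 = reg st 1 by [].
have rep1 := represents_mark rep r3 xv.
have -> : rmm_step e s rs =
    let vs := rcons (visits rs) x in
    if rightmost s [pred y | e x y & y \notin vs] is Some y
    then RmmState (rcons vs y) ([set x; y] |: matching rs) else RmmState vs (matching rs).
  by case: (rs) max_x => vs M /= ->.
apply: runs_then; apply: runs_loop_free => //.
move: (run (mark 3) st) r3m a4m r1m rep1 => st1 r3m a4m r1m rep1.
apply: runs_then; apply: runs_loop_free => //; apply: runs_then.
have [[_ _ i1 _] _ _ _ _ _ _ _ _] := rep1.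
have rep1' : represents (RmmState (rcons (visits rs) x) (matching rs))
    (run open_scan st1).
  exact: represents_regs rep1.
have loop := runs_scan rep1' r3m.
apply: runs_weaken (leqnn _) _ (loop _ _ _) => //; last first.
- by rewrite /= /update /= r3m i1 input_offsetS.
- by rewrite /= /update /= r3m i1.
move=> st2 [ea er e6]; apply: runs_loop_free => //=; rewrite e6.
have r3' : reg st2 3 = vnum x by rewrite er.
have r1' : reg st2 1 = reg st 1 by rewrite er.
have rep2 : represents (RmmState (rcons (visits rs) x) (matching rs)) st2.
  by apply: represents_regs rep1; rewrite ?ea ?er.
case: bestP e6 => [|y exy yv] //= e6; split=> //.
have xy : x != y by apply: contraNneq yv => <-; rewrite mem_rcons mem_head.
pose st3 := set_reg st2 6 (vnum y).
have rep3 : represents (RmmState (rcons (visits rs) x) (matching rs)) st3.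
  exact: represents_regs rep2.
(* Array 4 is untouched until [link], so the entries of [x] and [y] are still 0. *)
have a4 : arr (run (mark 6) st3) 4 = arr st 4.
  by rewrite -a4m; apply: (congr1 (fun f => f 4) ea).
have [[_ i0 _ _] _ _ _ _ _ _ _ _] := rep2.
rewrite i0 input_order -/st3.
apply: (@represents_link (RmmState (rcons (rcons (visits rs) x) y) (matching rs))
  (run (mark 6) st3)) => //.
- exact: (@represents_mark 6 (RmmState (rcons (visits rs) x) (matching rs))).
- by rewrite /= mem_rcons inE mem_rcons mem_head orbT.
- by rewrite /= mem_rcons mem_head.
- by rewrite a4 (rep_unmatched rep).
- rewrite a4 (rep_unmatched rep) //.
  by apply: contra yv; rewrite mem_rcons inE orbC => ->.
Qed.

Definition main_cost d := cmd_cost (Assign 1 (Pred (Reg 1)) ;; Assign 3 (Get 0 (Reg 1)))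
  + (test_cost (Eq (Get 6 (Reg 3)) (Const 0)) + visit_cost d).

(** After [k] positions only [j <= k] steps of RMM have been made, since a vertex already visited as
    a partner costs a position but no step. *)
Definition main_invariant k st := exists rs,
  [/\ represents rs st, reg st 1 = #|T| - k,
      forall x, #|T| - k <= pos x -> x \in visits rs
    & exists2 j, j <= k & rs = iter j (rmm_step e s) (RmmState [::] set0)].

Lemma visits_step rs x : x \in visits rs -> x \in visits (rmm_step e s rs).
Proof.
case: rs => vs M /= xv; case: rightmost => //= y; case: rightmost => /= [z|].
  by rewrite !(mem_rcons, inE) xv !orbT.
by rewrite mem_rcons inE xv orbT.
Qed.

Lemma visited_step rs x :
  rightmost s [pred z | z \notin visits rs] = Some x -> x \in visits (rmm_step e s rs).
Proof.
case: rs => vs M /= ->; case: rightmost => /= [z|].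
  by rewrite !(mem_rcons, inE) eqxx !orbT.
by rewrite mem_rcons mem_head.
Qed.

Let main_costs := [seq main_cost (size (adj x)) | x <- rev s].

Lemma runs_main_body k st : k < #|T| -> main_invariant k st ->
  runs main_body st (nth 0 main_costs k) (main_invariant k.+1).
Proof.
move=> kT [rs [rep r1 vis [j jk def]]].
have nk : #|T| - k = (#|T| - k.+1).+1 by lia.
have [x px] : exists x, pos x = #|T| - k.+1 by apply: ex_pos; lia.
have -> : nth 0 main_costs k = main_cost (size (adj x)).
  rewrite (nth_map x) ?size_rev ?(size_ordering s_order) //.
  rewrite nth_rev ?(size_ordering s_order) //.
  by rewrite -px nth_index ?(mem_ordering s_order).
apply: runs_then; apply: runs_loop_free => //.
have [[_ i0 _ _] _ _ _ _ _ _ _ _] := rep.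
rewrite [run _ _]/= /update /= r1 nk /= i0 -px input_order.
pose st1 := set_reg (set_reg st 1 (pos x)) 3 (vnum x); rewrite -/st1.
have rep1 : represents rs st1 by apply: represents_regs rep.
apply: runs_if; rewrite [holds _ _]/= (rep_visited rep1).
have split_pos z : #|T| - k.+1 <= pos z -> z = x \/ #|T| - k <= pos z.
  rewrite leq_eqVlt -px => /predU1P[/(index_ordering_inj s_order)|]; first by left.
  by rewrite px -nk; right.
case xv: (x \in visits rs) => /=.
  exists 1, st1; split; [by constructor | by [] |].
  exists rs; split=> //.
    by move=> z /split_pos[->|/vis].
  by exists j => //; apply: ltnW.
(* Everything to the right of [x] is visited by the invariant, so the scan agrees with the choice
   made by RMM. *)
have max_x : rightmost s [pred z | z \notin visits rs] = Some x.
  apply: rightmost_unique => //=; first by rewrite xv.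
  move=> z zv; rewrite leqNgt; apply: contra zv => xz; apply: vis.
  by rewrite nk -px.
apply: runs_weaken (leqnn _) _ (@runs_visit rs st1 x rep1 _ max_x) => // st2 [rep2 r12].
exists (rmm_step e s rs); split=> //; first by rewrite r12 /= /update /= px.
  by move=> z /split_pos[->|/vis/visits_step //]; apply: visited_step.
by exists j.+1; rewrite // def.
Qed.

Definition init_invariant k st :=
  [/\ input_kept st, reg st 1 = k, reg st 2 = 0
    & forall x : T, [/\ pos x < k -> arr st 5 (vnum x) = (pos x).+1,
                        arr st 4 (vnum x) = 0 & arr st 6 (vnum x) = 0]].

Lemma runs_init_body k st : k < #|T| -> init_invariant k st ->
  runs init_body st (cmd_cost init_body) (init_invariant k.+1).
Proof.
move=> kT [[i0 i1 i2 i3] r1 r2 vs]; apply: runs_loop_free => //.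
have [x px] := ex_pos kT.
split=> // [|y]; first by rewrite /= /update /= r1.
have [y5 y4 y6] := vs y; split=> //.
rewrite /= /update /= r1 i1 -px input_order (inj_eq vnum_inj).
case: eqP => [->//|yx]; rewrite ltnS leq_eqVlt px => /predU1P[yk|//].
by case: yx; apply: (index_ordering_inj s_order); rewrite yk.
Qed.

Lemma init_main st : init_invariant #|T| st -> main_invariant 0 st.
Proof.
move=> [kept r1 r2 vs]; exists (RmmState [::] set0); split; last by exists 0.
- split=> //= x; have [x5 x4 x6] := vs x => //.
  + by apply: x5; rewrite -(size_ordering s_order) index_mem (mem_ordering s_order).
  + by rewrite x4.
  + by move=> y; rewrite x4 in_set0.
- by rewrite subn0.
move=> x; rewrite subn0 leqNgt -(size_ordering s_order).
by rewrite index_mem (mem_ordering s_order).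
Qed.

Lemma main_returns st : main_invariant #|T| st -> returns st (rmm e s).
Proof.
move=> [rs [rep _ vis [j jT def]]].
have all_visited x : x \in visits rs by apply: vis; rewrite subnn.
have fix_rs : rmm_step e s rs = rs.
  case: (rs) all_visited => vs M /= all_visited; rewrite rightmost_none //= => z.
  by rewrite all_visited.
have -> : rmm e s = rs.
  (* The [#|T| - j] surplus iterations of [rmm] act on a fixed point. *)
  rewrite /rmm -(subnK jT) iterD -def; elim: (_ - j) => //= i ->.
  exact: fix_rs.
case: rep => _ _ uv _ ev _ lev mv _; split=> //.
suff <- : size (visits rs) = #|T| by [].
rewrite cardE; apply/perm_size/uniq_perm; rewrite ?enum_uniq // => x.
by rewrite mem_enum all_visited.
Qed.

Definition total_cost :=
  (\sum_(k < #|T|) (3 + cmd_cost init_body) + 3) +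
  (\sum_(k < #|T|) (3 + nth 0 main_costs k) + 3).

Lemma runs_rmm_program :
  runs rmm_program inp total_cost (fun st => returns st (rmm e s)).
Proof.
have init0 : init_invariant 0 inp.
  by split=> // x; split=> //; rewrite /= nth_nil.
apply: runs_then.
apply: runs_weaken (leqnn _) _
  (@runs_while _ _ _ (fun=> cmd_cost init_body) _ _ _ _ init0).
- move=> st /init_main main0.
  apply: runs_weaken (leqnn _) main_returns
    (@runs_while _ _ _ (nth 0 main_costs) _ _ _ _ main0).
  + move=> k st' kT inv; split; last exact: runs_main_body.
    by case: inv => rs [_ r1 _ _]; rewrite /= r1 subn_gt0.
  + by move=> st' [rs [_ r1 _ _]]; rewrite /= r1 subnn.
- move=> k st kT inv; split; last exact: runs_init_body.
  by case: inv => [[r0 _ _ _] r1 _ _]; rewrite /= r0 r1.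
by move=> st [[r0 _ _ _] r1 _ _]; rewrite /= r0 r1 ltnn.
Qed.

(** Each edge is read at most twice, which gives the first summand. The 12 covers two loop tests per
    vertex and the two final failing tests, each of cost 3; the final ones are absorbed because
    there is at least one vertex. *)
Definition cost_factor :=
  2 * (3 + cmd_cost scan_body) + (12 + cmd_cost init_body + main_cost 0).

Lemma total_cost_linear : 0 < #|T| -> total_cost <= cost_factor * (#|T| + #|edges e|).
Proof.
move=> n_gt0; have deg : \sum_x size (adj x) <= 2 * #|edges e|.
  apply: leq_trans (sum_degrees e_simple); apply: leq_sum => x _.
  by rewrite (perm_size (adj_lists x)) cardE.
(* The cost of treating a vertex is affine in its degree, so the total depends only on [#|T|] and
   the degree sum. *)
have costE d : main_cost d = main_cost 0 + d * (3 + cmd_cost scan_body).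
  rewrite /main_cost /visit_cost /scan_cost; lia.
have mains : \sum_(k < #|T|) nth 0 main_costs k =
    #|T| * main_cost 0 + (\sum_x size (adj x)) * (3 + cmd_cost scan_body).
  have <- : size main_costs = #|T| by rewrite size_map size_rev (size_ordering s_order).
  rewrite -(big_mkord predT (nth 0 main_costs)) -(big_nth 0 predT id) big_map.
  rewrite size_map size_rev (size_ordering s_order).
  rewrite (perm_big (enum T)) /=; last by rewrite perm_rev.
  rewrite big_enum /= (eq_bigr _ (fun x _ => costE _)) big_split /=.
  by rewrite sum_nat_const big_distrl.
have tests : \sum_(k < #|T|) (3 + nth 0 main_costs k)
    = #|T| * 3 + \sum_(k < #|T|) nth 0 main_costs k.
  by rewrite big_split sum_nat_const card_ord.
rewrite /total_cost tests mains sum_nat_const card_ord /cost_factor.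
move: deg; move: (\sum_x _) (3 + cmd_cost scan_body) (main_cost 0) (cmd_cost init_body).
move=> D b a i Dm; have Db : D * b <= 2 * #|edges e| * b by rewrite leq_mul.
nia.
Qed.

End Implementation.

Theorem theorem2 :
  exists (p : cmd) (c : nat),
    implements_rmm p /\
    forall (T : finType) (e : rel T) (s : seq T),
      simple_graph e -> cocomparability e ->
      is_ordering s -> ldfs_ordering e s -> umbrella_free e s ->
      is_maximum_matching e (matching (rmm e s)) /\
      forall (adj : T -> seq T) (t : nat) (st : store),
        adjacency_lists e adj -> exec p (input s adj) t st ->
        0 < #|T| -> t <= c * (#|T| + #|edges e|).
Proof.
exists rmm_program, cost_factor; split.
  move=> T e s adj e_simple s_order adj_lists.
  have [t [st [ex _ ret]]] := runs_rmm_program s_order adj_lists.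
  by exists t, st.
move=> T e s e_simple _ s_order s_ldfs s_umbrella; split.
  exact: rmm_maximum.
move=> adj t st adj_lists ex n_gt0.
have [t' [st' [ex' le _]]] := runs_rmm_program s_order adj_lists.
have [-> _] := exec_deterministic ex ex'.
exact: leq_trans le (total_cost_linear e_simple s_order adj_lists n_gt0).
Qed.
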